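(* Let $G$ be a connected graph that is not a tree, with $m$ edges and edge-connectivity $\lambda$, and let $w$ be a normalised weight function on $E(G)$. Then $$0\leq \mathrm{avec}(G,w)\leq \frac{m}{\lambda}.$$
   Context: Graphs are finite and simple. For a connected graph $G$ with $n$ vertices and $m$ edges, a weight function is a map $w:E(G)\to\mathbb{R}^{\geq 0}$; it is called normalised if $\sum_{e\in E(G)}w(e)=m$. The weighted distance $d_w(u,v)$ is the minimum, over all paths between $u$ and $v$ in $G$, of the sum of the weights of the edges of the path. The weighted eccentricity of a vertex $v$ is $e_w(v)=\max_{u\in V(G)}d_w(u,v)$, and the average eccentricity is $\mathrm{avec}(G,w)=\frac1n\sum_{v\in V(G)}e_w(v)$. The edge-connectivity $\lambda$ of $G$ is the smallest number of edges whose deletion disconnects $G$. *)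

(* Defs.v *)
From HB Require Import structures.
From mathcomp Require Import all_boot all_order all_algebra.
From mathcomp Require Import reals.

Set Implicit Arguments.
Unset Strict Implicit.
Unset Printing Implicit Defensive.

Import Order.TTheory GRing.Theory Num.Theory.
Local Open Scope ring_scope.

(* A finite simple graph is a symmetric irreflexive relation on a finite type
   of vertices; an edge is an unordered pair [set x; y]. *)
Definition simple_graph (T : finType) (e : rel T) : Prop :=
  symmetric e /\ irreflexive e.

Definition edges (T : finType) (e : rel T) : {set {set T}} :=
  [set [set xy.1; xy.2] | xy : T * T & e xy.1 xy.2].

Definition connected_graph (T : finType) (e : rel T) : bool :=
  (0 < #|T|)%N && [forall x, forall y, connect e x y].

(* ucycle also accepts [::] and, for an edge xy, [:: x; y]: these are not
   cycles of a simple graph. *)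
Definition acyclic_graph (T : finType) (e : rel T) : Prop :=
  forall c : seq T, ucycle e c -> (size c < 3)%N.

Definition is_tree (T : finType) (e : rel T) : Prop :=
  connected_graph e /\ acyclic_graph e.

Definition delete_edges (T : finType) (e : rel T) (S : {set {set T}}) : rel T :=
  [rel x y | e x y && ([set x; y] \notin S)].

Definition disconnecting (T : finType) (e : rel T) (S : {set {set T}}) : bool :=
  (S \subset edges e) && ~~ connected_graph (delete_edges e S).

(* The default set edges e is itself disconnecting once there are two
   vertices; for the one-vertex graph the value is 0. *)
Definition edge_connectivity (T : finType) (e : rel T) : nat :=
  #|[arg min_(S < edges e | disconnecting e S) #|S|]|.

(* Only the values of w on edges e matter. *)
Definition weight_function (R : realType) (T : finType) (e : rel T)
    (w : {set T} -> R) : Prop :=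
  forall a, a \in edges e -> 0 <= w a.

Definition normalised (R : realType) (T : finType) (e : rel T)
    (w : {set T} -> R) : Prop :=
  \sum_(a in edges e) w a = #|edges e|%:R.

(* The path with vertex sequence u :: p is represented by p, whose length is
   less than #|T| since vertices are not repeated. *)
Definition paths_between (T : finType) (e : rel T) (u v : T) :
    {set {bseq #|T| of T}} :=
  [set p : {bseq #|T| of T} | [&& path e u p, last u p == v & uniq (u :: p)]].

Definition path_weight (R : realType) (T : finType) (w : {set T} -> R)
    (u : T) (p : seq T) : R :=
  \sum_(xy <- zip (u :: p) p) w [set xy.1; xy.2].

(* The least element of s (0 if s is empty); the neutral value of the big
   operator is taken in s so that it does not affect the minimum. *)
Definition seq_min (R : realType) (s : seq R) : R :=
  \big[Num.min/head 0 s]_(x <- s) x.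

Definition wdist (R : realType) (T : finType) (e : rel T) (w : {set T} -> R)
    (u v : T) : R :=
  seq_min [seq path_weight w u p | p : {bseq #|T| of T} in paths_between e u v].

(* The neutral value is again one of the values over which the maximum is
   taken. *)
Definition wecc (R : realType) (T : finType) (e : rel T) (w : {set T} -> R)
    (v : T) : R :=
  \big[Num.max/wdist e w v v]_(u : T) wdist e w u v.

Definition avec (R : realType) (T : finType) (e : rel T) (w : {set T} -> R)
    : R :=
  (#|T|%:R)^-1 * \sum_(v : T) wecc e w v.

(* Main.v *)
Require Import Defs.
From HB Require Import structures.
From mathcomp Require Import all_boot all_order all_algebra.
From mathcomp Require Import reals.

(** Write [lam] for the edge-connectivity. It suffices to show that
    [lam * d_w(u, v) <= m] for all vertices [u] and [v]; averaging over [v] the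
    maximum over [u] then gives the upper bound.

    Instead of taking [lam] edge-disjoint paths from Menger's theorem, the proof
    uses the easy half of that duality, a coarea argument. Let [f] be the
    distance from [u]. It is 1-Lipschitz for [w] ([wdist_edge]), that is,
    [|f x - f y| <= w xy] for every edge [xy]. For each level [t] between
    [f u = 0] and [f v], the edges crossing from [f <= t] to [f > t] separate
    [u] from [v], so there are at least [lam] of them ([edge_connectivity_le]).
    Integrating over [t] and exchanging sums,
    [lam * (f v - f u) <= \sum_(xy) |f x - f y| <= \sum_(xy) w xy = m]
    ([edge_connectivity_coarea]). The integral is a finite sum over the sorted
    list of the values of [f]. A graph that is not a tree has at least two
    vertices, hence [lam > 0] and one may divide by it. *)

Set Implicit Arguments.
Unset Strict Implicit.
Unset Printing Implicit Defensive.

Import Order.TTheory GRing.Theory Num.Theory.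
Local Open Scope ring_scope.

(** * Minimum of a sequence *)

Lemma seq_min_le (R : realType) (s : seq R) (x : R) :
  x \in s -> seq_min s <= x.
Proof.
rewrite /seq_min; move: (head 0 s) => z.
elim: s => [//|a s IHs]; rewrite big_cons inE ge_min.
by case/predU1P => [->|/IHs ->]; rewrite ?lexx ?orbT.
Qed.

Lemma seq_min_in (R : realType) (s : seq R) :
  s != [::] -> seq_min s \in s.
Proof.
case: s => [//|a s] _; rewrite /seq_min big_cons /=.
have : \big[Num.min/a]_(x <- s) x \in a :: s.
  rewrite big_seq; elim/big_ind: _ => [|x y xs ys|x xs].
  - exact: mem_head.
  - by rewrite /Num.min; case: ifP.
  - by rewrite inE xs orbT.
by rewrite /Num.min; case: ifP => // _ _; exact: mem_head.
Qed.

(** * Weighted distance *)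

Lemma edges_in (T : finType) (e : rel T) (x y : T) :
  e x y -> [set x; y] \in edges e.
Proof. by move=> exy; apply/imsetP; exists (x, y); rewrite ?inE. Qed.

Section Distance.

Variables (R : realType) (T : finType) (e : rel T) (w : {set T} -> R).

Lemma path_weight_cat (u : T) (p q : seq T) :
  path_weight w u (p ++ q) = path_weight w u p + path_weight w (last u p) q.
Proof.
rewrite /path_weight; elim: p u => [|a p IHp] u /=; first by rewrite big_nil add0r.
by rewrite !big_cons IHp addrA.
Qed.

Lemma path_weight_rcons (u y : T) (p : seq T) :
  path_weight w u (rcons p y) = path_weight w u p + w [set last u p; y].
Proof.
by rewrite -cats1 path_weight_cat {2}/path_weight /= big_cons big_nil addr0.
Qed.

Hypothesis hw : weight_function e w.

Lemma path_weight_ge0 (u : T) (p : seq T) : path e u p -> 0 <= path_weight w u p.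
Proof.
rewrite /path_weight; elim: p u => [|a p IHp] u /=; first by rewrite big_nil.
by case/andP=> eua ep; rewrite big_cons addr_ge0 ?IHp ?hw ?edges_in.
Qed.

Lemma wdist_le (u v : T) (p : seq T) :
  path e u p -> last u p = v -> uniq (u :: p) -> wdist e w u v <= path_weight w u p.
Proof.
move=> ep lp up.
(* A repetition-free path has fewer than #|T| edges, so it is one of the
   bounded sequences of the definition. *)
have sp : (size p <= #|T|)%N by rewrite ltnW //
    -[(size p).+1]/(size (u :: p)) -(card_uniqP up) max_card.
apply: seq_min_le; apply/imageP; exists (Bseq sp) => //.
by rewrite inE ep lp eqxx up.
Qed.

Hypothesis hconn : connected_graph e.

Lemma wdist_attained (u v : T) :
  exists p, [/\ path e u p, last u p = v, uniq (u :: p) &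
                wdist e w u v = path_weight w u p].
Proof.
have : wdist e w u v \in
    [seq path_weight w u p | p : {bseq #|T| of T} in paths_between e u v].
  apply: seq_min_in.
  have /connectP[p ep ->] : connect e u v by case/andP: hconn => _ /forallP/(_ u)/forallP.
  case/shortenP: ep => q eq uq _.
  have sq : (size q <= #|T|)%N by rewrite ltnW //
    -[(size q).+1]/(size (u :: q)) -(card_uniqP uq) max_card.
  rewrite -size_eq0 size_map -lt0n -cardE; apply/card_gt0P; exists (Bseq sq).
  by rewrite inE eq eqxx uq.
by case/imageP=> p; rewrite inE => /and3P[ep /eqP lp up] ->; exists p.
Qed.

Lemma wdist_ge0 (u v : T) : 0 <= wdist e w u v.
Proof.
by have [p [ep _ _ ->]] := wdist_attained u v; exact: path_weight_ge0.
Qed.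

Lemma wdist_refl (u : T) : wdist e w u u = 0.
Proof.
apply/le_anti; rewrite wdist_ge0 andbT.
have := @wdist_le u u [::] isT erefl isT.
by rewrite /path_weight big_nil.
Qed.

Lemma wdist_edge (u x y : T) :
  e x y -> wdist e w u y - wdist e w u x <= w [set x; y].
Proof.
move=> exy; rewrite lerBlDl; have [p [ep lp up ->]] := wdist_attained u x.
have wxy : 0 <= w [set x; y] by rewrite hw ?edges_in.
have [yp|yp] := boolP (y \in u :: p).
  (* The path to x already visits y: its initial segment is a path to y. *)
  case/splitPl: yp ep up lp => p1 p2 lp1.
  rewrite cat_path -cat_cons cat_uniq => /andP[ep1 ep2] /andP[up1 _] _.
  rewrite path_weight_cat -addrA (le_trans (wdist_le ep1 lp1 up1)) //.
  by rewrite lerDl addr_ge0 ?path_weight_ge0.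
rewrite -[in w _]lp -path_weight_rcons wdist_le ?last_rcons //.
  by rewrite rcons_path ep lp.
by rewrite -rcons_cons rcons_uniq yp up.
Qed.

End Distance.

(** * Cuts and edge-connectivity *)

Lemma edges_disconnecting (T : finType) (e : rel T) (u v : T) :
  u != v -> disconnecting e (edges e).
Proof.
move=> uv; rewrite /disconnecting subxx /=.
apply/negP=> /andP[_ /forallP/(_ u)/forallP/(_ v)/connectP[[|a p] /=]].
  by move=> _ vu; rewrite vu eqxx in uv.
by case/andP=> /andP[eua]; rewrite edges_in.
Qed.

Lemma edge_connectivity_gt0 (T : finType) (e : rel T) (u v : T) :
  connected_graph e -> u != v -> (0 < edge_connectivity e)%N.
Proof.
move=> hconn uv; rewrite /edge_connectivity.
case: arg_minnP => [|S /andP[_ dS] _]; first exact: edges_disconnecting uv.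
rewrite lt0n cards_eq0; apply: contraNneq dS => ->.
case/andP: hconn => T0 /forallP ce; rewrite /connected_graph T0 /=.
apply/forallP=> x; apply/forallP=> y; have /forallP/(_ y) := ce x.
rewrite (@eq_connect _ (delete_edges e set0) e) // => a b.
by rewrite /delete_edges /= in_set0 andbT.
Qed.

(** The edges with one end in [A] and the other outside. *)
Definition cut (T : finType) (e : rel T) (A : pred T) : {set {set T}} :=
  [set a in edges e | [exists x in a, A x] && [exists y in a, ~~ A y]].

Lemma in_cut2 (T : finType) (e : rel T) (A : pred T) (x y : T) :
  e x y -> ([set x; y] \in cut e A) = (A x != A y).
Proof.
move=> exy; rewrite inE edges_in //=; apply/idP/idP.
  case/andP=> /existsP[a /andP[/set2P[]-> Aa]] /existsP[b /andP[/set2P[]-> Ab]];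
  by apply: contraNneq Ab => E; rewrite ?Aa // -?E ?Aa // E.
move=> Axy; apply/andP; split; apply/existsP.
  case Ax: (A x) Axy => Axy; [exists x|exists y]; rewrite !inE eqxx ?orbT ?Ax //=.
  by case: (A y) Axy.
case Ax: (A x) Axy => Axy; [exists y|exists x]; rewrite !inE eqxx ?orbT ?Ax //=.
Qed.

Lemma edge_connectivity_le (T : finType) (e : rel T) (A : pred T) (u v : T) :
  A u -> ~~ A v -> (edge_connectivity e <= #|cut e A|)%N.
Proof.
move=> Au Av; have uv : u != v by apply: contraNneq Av => <-.
rewrite /edge_connectivity.
case: arg_minnP => [|S _]; first exact: edges_disconnecting uv.
apply; apply/andP; split; first by apply/subsetP=> a; rewrite inE => /andP[].
apply/negP=> /andP[_ /forallP/(_ u)/forallP/(_ v)/connectP[p ep vp]].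
case/negP: Av; rewrite {}vp; elim: p u Au {uv} ep => //= a p IHp u Au.
case/andP=> /andP[eua]; rewrite in_cut2 // negbK Au => /eqP Aa.
by apply: IHp; rewrite -Aa.
Qed.

(** * The coarea inequality *)

(** Since [w] dominates the oscillation of [f] on every edge, its total is at
    least the sum, over all levels of [f], of the sizes of the level cuts. *)
Lemma edge_connectivity_coarea (R : realType) (T : finType) (e : rel T)
    (w : {set T} -> R) (f : T -> R) (u v : T) :
    symmetric e -> weight_function e w ->
    (forall x y, e x y -> f y - f x <= w [set x; y]) ->
  (edge_connectivity e)%:R * (f v - f u) <= \sum_(a in edges e) w a.
Proof.
move=> esym hw hf.
pose s := sort <=%R [seq f x | x : T].
pose N := (size s).-1.
(* A vertex is ranked by the position of its value in the sorted list; the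
   level cuts are taken with respect to the rank. *)
pose r x := index (f x) s.
pose d i := s`_i.+1 - s`_i.
have fs x : f x \in s by rewrite mem_sort; apply: image_f.
have s0 : (0 < size s)%N
  by apply: leq_ltn_trans (leq0n (r u)) _; rewrite index_mem.
have rN x : (r x <= N)%N by rewrite -ltnS /N prednK // index_mem.
have d0 i : (i < N)%N -> 0 <= d i.
  move=> iN; rewrite subr_ge0; apply: sorted_leq_nth => //.
  - exact: le_trans.
  - exact: sort_le_sorted.
  - by rewrite inE (leq_trans iN) ?leq_pred.
  - by rewrite inE -(prednK s0) ltnS.
have layer x y : (r x <= r y)%N ->
    f y - f x = \sum_(0 <= i < N | (r x <= i < r y)%N) d i.
  move=> rxy; transitivity (\sum_(r x <= i < r y) d i).
    by rewrite telescope_sumr // !nth_index.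
  rewrite (big_nat_widen _ _ _ _ _ (rN y)) (big_nat_widenl _ _ _ _ _ (leq0n (r x))).
  by apply: eq_bigl => i; rewrite andbC.
have layer_ge0 (P : pred nat) : 0 <= \sum_(0 <= i < N | P i) d i.
  by rewrite big_nat_cond sumr_ge0 // => i /andP[/andP[_ iN] _]; exact: d0.
pose A i := [pred x | (r x <= i)%N].
have edge_le a : a \in edges e -> \sum_(0 <= i < N | a \in cut e (A i)) d i <= w a.
  case/imsetP=> -[x y]; rewrite inE /= => exy ->.
  wlog rxy : x y exy / (r x <= r y)%N => [hwlog|].
    have [/hwlog->//|/ltnW ryx] := leqP (r x) (r y).
    by rewrite setUC; apply: hwlog ryx; rewrite esym.
  apply: le_trans (hf x y exy); rewrite (layer x y) //.
  rewrite le_eqVlt; apply/orP; left; apply/eqP/eq_bigl => i; rewrite in_cut2 //=.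
  case: (leqP (r x) i) => rxi; case: (leqP (r y) i) => ryi //.
  by rewrite leqNgt (leq_trans rxi rxy) in ryi.
have [ruv|/ltnW rvu] := leqP (r u) (r v); last first.
  (* Here f v <= f u and the left-hand side is not positive. *)
  apply: (@le_trans _ _ 0); last by apply: sumr_ge0 => a /hw.
  by rewrite mulr_ge0_le0 // -oppr_ge0 opprB (layer v u).
apply: le_trans (ler_sum _ edge_le); rewrite layer // big_distrr /=.
rewrite (exchange_big_dep (fun=> true)) //= [leLHS]big_mkcond /=.
rewrite [leLHS]big_nat [leRHS]big_nat; apply: ler_sum => i /andP[_ iN].
case: ifP => [/andP[rui riv]|_]; last by apply: sumr_ge0 => _ _; exact: d0.
rewrite sumr_const -[leRHS]mulr_natl ler_wpM2r ?d0 // ler_nat.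
apply: leq_trans (@edge_connectivity_le _ e (A i) u v _ _) _ => //=.
  by rewrite -ltnNge.
by apply: subset_leq_card; apply/subsetP=> a aC; rewrite unfold_in aC andbT;
  move: aC; rewrite inE => /andP[].
Qed.

Lemma card_gt1_of_not_tree (T : finType) (e : rel T) :
  connected_graph e -> ~ is_tree e -> (1 < #|T|)%N.
Proof.
move=> hconn ntree; rewrite ltnNge; apply/negP=> T1; apply: ntree; split=> // c.
case/andP=> _ uc; rewrite -(card_uniqP uc) ltnS ltnW // ltnS.
exact: leq_trans (max_card _) T1.
Qed.

Theorem theorem3p4 (R : realType) (T : finType) (e : rel T) (w : {set T} -> R)
    (hG : simple_graph e) (hconn : connected_graph e) (hntree : ~ is_tree e)
    (hw : weight_function e w) (hnorm : normalised e w) :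
  0 <= avec e w /\
  avec e w <= #|edges e|%:R / (edge_connectivity e)%:R.
Proof.
have T1 := card_gt1_of_not_tree hconn hntree.
have T0 : 0 < #|T|%:R :> R by rewrite ltr0n (ltnW T1).
have lam0 : 0 < (edge_connectivity e)%:R :> R.
  have /card_gt1P[x [y [_ _ xy]]] := T1.
  by rewrite ltr0n (edge_connectivity_gt0 hconn xy).
have dist_le u v : wdist e w u v <= #|edges e|%:R / (edge_connectivity e)%:R.
  have := @edge_connectivity_coarea _ _ e w (wdist e w u) u v hG.1 hw _.
  rewrite wdist_refl // subr0 hnorm ler_pdivlMr // mulrC; apply=> x y.
  exact: wdist_edge.
have ecc_ge0 v : 0 <= wecc e w v.
  by rewrite /wecc; elim/big_rec: _ => [|u x _ x0];
    rewrite ?le_max ?wdist_ge0.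
have ecc_le v : wecc e w v <= #|edges e|%:R / (edge_connectivity e)%:R.
  rewrite /wecc; elim/big_rec: _ => [|u x _ xle]; first exact: dist_le.
  by rewrite ge_max dist_le.
split; first by rewrite mulr_ge0 ?sumr_ge0 // invr_ge0 ltW.
rewrite ler_pdivrMl //; apply: (le_trans (ler_sum _ (fun v _ => ecc_le v))).
by rewrite sumr_const [leRHS]mulr_natl.
Qed.
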